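(* Let $S=\{s_2,s_1\}$ with $s_1>s_2$ be the action set of a cumulative subtraction game with exactly two actions, and let $\alpha=s_1-s_2$. The outcomes of the game $S$ are $$o(x)=\begin{cases} is_2-(i-1)s_1=s_1-i\alpha, & \text{if } x\in X^*(i),\\ 0, & \text{if } y-s_1+i\alpha\le x<y, \text{ where } y\in X^*(i),\\ o(y), & \text{if there is } y\equiv x \pmod{2s_1} \text{ such that } y\in X^*(i), \text{ with } y<x,\\ s_1-o(x-s_1), & \text{for all } [x]_{2s_1}\in\{s_1,\ldots,2s_1-1\}.\end{cases}$$
   Context: Cumulative subtraction (CS): $S$ is a finite set of positive integers with $|S|\ge 2$. Starting from a heap of $x\in\mathbb{Z}_{\ge 0}$ pebbles and score $0$, two players, Positive (who starts) and Negative, alternate in removing $s\in S$ pebbles, with $s$ at most the current heap size; Positive's move adds $s$ to the score and Negative's move subtracts $s$. The game ends when the heap is smaller than $\min S$. Positive maximizes and Negative minimizes the terminal score. Outcome function: $o$ is defined recursively on heap sizes $x\in\mathbb{Z}_{\ge 0}$ by $o(x)=0$ if $x<\min S$ and $o(x)=\max\{s-o(x-s)\mid s\in S,\ s\le x\}$ if $x\ge\min S$. The sets $X^*(i)$: for $S=\{s_2,s_1\}$ with $s_1>s_2$ and $\alpha=s_1-s_2$, for each positive integer $i$ with $is_2>(i-1)s_1$, let $X^*(i)=\{is_2+(i-1)s_1+\delta\mid\delta\in\{0,1,\ldots,\alpha-1\}\}$; for all other positive integers $i$ let $X^*(i)=\varnothing$. $[x]_y$ denotes the smallest non-negative number congruent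 to $x$ modulo $y$.
   Formalization: The first case, when i=1, is claimed only for x with floor(x/s_2) odd (it fails otherwise: S={1,3}, o(2)=0, not 1; automatic if s_1≤2s_2); the second case is claimed only for x in no X*(j), i.e. the first applicable case wins (S={3,5}: o(3)=3). *)

(* Defs.v *)
From HB Require Import structures.
From mathcomp Require Import all_boot all_order all_algebra.

Set Implicit Arguments.
Unset Strict Implicit.
Unset Printing Implicit Defensive.

Import Order.TTheory GRing.Theory Num.Theory.
Local Open Scope ring_scope.

(* The default values head 0 _ are reached on the empty sequence only. *)
Definition minS (S : seq nat) : nat := \big[minn/head 0 S]_(s <- S) s.
Definition maxseq (vs : seq int) : int := \big[Num.max/head 0 vs]_(v <- vs) v.

(* The finite action set S is listed as a sequence; outcomeE below shows that
   outcome satisfies the defining recursion when all the actions are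
   positive, n being only the fuel that bounds the recursion depth. *)
Fixpoint outcome_rec (S : seq nat) (n x : nat) : int :=
  if n is m.+1 then
    if (x < minS S)%N then 0
    else maxseq [seq s%:Z - outcome_rec S m (x - s)%N | s <- S & (s <= x)%N]
  else 0.

Definition outcome (S : seq nat) (x : nat) : int := outcome_rec S x.+1 x.

Lemma outcome_rec_fuel (S : seq nat) (n m x : nat) :
  all (leq 1) S -> (x < n)%N -> (x < m)%N ->
  outcome_rec S n x = outcome_rec S m x.
Proof.
move=> S_gt0; elim: n m x => // n IHn [|m] // x; rewrite !ltnS => xn xm /=.
case: ifP => // _; congr maxseq; apply/eq_in_map => s.
rewrite mem_filter => /andP[sx sS]; congr (_ - _).
have s_gt0 : (0 < s)%N by move/allP: S_gt0; apply.
have x_gt0 : (0 < x)%N by apply: leq_trans sx.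
have lt_x : (x - s < x)%N by rewrite ltn_subrL s_gt0.
by apply: IHn; [apply: leq_trans xn | apply: leq_trans xm].
Qed.

Lemma outcomeE (S : seq nat) (x : nat) : all (leq 1) S ->
  outcome S x =
    if (x < minS S)%N then 0
    else maxseq [seq s%:Z - outcome S (x - s)%N | s <- S & (s <= x)%N].
Proof.
move=> S_gt0; rewrite {1}/outcome /=.
case: ifP => // _; congr maxseq; apply/eq_in_map => s.
rewrite mem_filter => /andP[sx sS]; congr (_ - _).
have s_gt0 : (0 < s)%N by move/allP: S_gt0; apply.
have x_gt0 : (0 < x)%N by apply: leq_trans sx.
by apply: outcome_rec_fuel; rewrite // ltn_subrL s_gt0.
Qed.

(* Pitfall: if s1 > 2 * s2, the outcome is not constant on X*(1), which is
   {s2, ..., s1 - 1}.  On a heap x < s1 only s2 can be played, so that x %/ s2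
   forced moves are made and the outcome is s2 if that number is odd, and 0 if
   it is even (with S = {1, 3}, heap 2 has outcome 0).  If s1 <= 2 * s2 the
   quotient x %/ s2 is 1 on the whole of X*(1). *)
Definition Xstar (s1 s2 i : nat) : seq nat :=
  if ((0 < i) && ((i - 1) * s1 < i * s2))%N
  then [seq (i * s2 + (i - 1) * s1 + delta)%N | delta <- iota 0 (s1 - s2)]
  else [::].

(* Main.v *)
Require Import Defs.
From mathcomp Require Import all_boot all_order all_algebra.
From mathcomp Require Import zify.

Set Implicit Arguments.
Unset Strict Implicit.
Unset Printing Implicit Defensive.

Import Order.TTheory GRing.Theory Num.Theory.
Local Open Scope ring_scope.

(** Write a heap as x = 2 s1 q + r (lower half) or 2 s1 q + s1 + r (upper half)
    with r < s1.  In the upper half the greedy move s1 is optimal, and in the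
    lower half the outcome satisfies o_q(r) = max (o_(q-1)(r), o_(q-1)(r + alpha)
    - alpha) for r < s2, because both moves lead to the upper half of the previous
    block.  Hence the value s2 on the residues [s1 - alpha, s1) spreads by one more
    interval of length alpha, losing alpha, each time q increases: the residues
    [s1 - i alpha, s1 - (i-1) alpha) have outcome s1 - i alpha as soon as
    q >= i - 1, which is the block where X*(i) lies.  If 2 s2 <= s1 nothing
    spreads, and the outcome on the lower half is that of forced moves s2. *)

(* With i = depth + 1, r lies in [s1 - i alpha, s1 - (i-1) alpha), which is X*(i)
   modulo 2 s1 when X*(i) is nonempty. *)
Definition depth (s1 s2 r : nat) : nat := ((s1 - 1 - r) %/ (s1 - s2))%N.

(* The subtraction s1 - ... is truncated: it gives 0 when X*(depth + 1) is empty. *)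
Definition low (s1 s2 q r : nat) : nat :=
  (if 2 * s2 <= s1 then if odd (r %/ s2) then s2 else 0
   else if depth s1 s2 r <= q then s1 - (depth s1 s2 r).+1 * (s1 - s2)
   else 0)%N.

Lemma outcome_small (s1 s2 x : nat) : (0 < s2 < s1)%N -> (x < s2)%N ->
  outcome [:: s2; s1] x = 0.
Proof.
move=> s2P xs2; rewrite outcomeE /=; last by lia.
suff -> : minS [:: s2; s1] = s2 by rewrite xs2.
by rewrite /minS !big_cons big_nil /=; lia.
Qed.

Lemma outcome_mid (s1 s2 x : nat) : (0 < s2 < s1)%N -> (s2 <= x < s1)%N ->
  outcome [:: s2; s1] x = s2%:Z - outcome [:: s2; s1] (x - s2)%N.
Proof.
move=> s2P xP; rewrite [LHS]outcomeE /=; last by lia.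
have -> : minS [:: s2; s1] = s2 by rewrite /minS !big_cons big_nil /=; lia.
have -> : (x < s2)%N = false by lia.
have -> : (s2 <= x)%N = true by lia.
have -> : (s1 <= x)%N = false by lia.
by rewrite /maxseq /= big_cons big_nil maxxx.
Qed.

Lemma outcome_big (s1 s2 x : nat) : (0 < s2 < s1)%N -> (s1 <= x)%N ->
  outcome [:: s2; s1] x =
    Num.max (s2%:Z - outcome [:: s2; s1] (x - s2)%N)
            (s1%:Z - outcome [:: s2; s1] (x - s1)%N).
Proof.
move=> s2P xP; rewrite [LHS]outcomeE /=; last by lia.
have -> : minS [:: s2; s1] = s2 by rewrite /minS !big_cons big_nil /=; lia.
have -> : (x < s2)%N = false by lia.
have -> : (s2 <= x)%N = true by lia.
have -> : (s1 <= x)%N = true by lia.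
by rewrite /maxseq /= !big_cons big_nil [Num.max (s1%:Z - _) _]maxC maxA maxxx.
Qed.

Lemma depth_eq (s1 s2 r k : nat) : (s2 < s1)%N -> (r < s1)%N ->
  (s1 <= r + k.+1 * (s1 - s2))%N -> (r + k * (s1 - s2) < s1)%N ->
  depth s1 s2 r = k.
Proof.
move=> s21 rs1 lo hi; have a_gt0 : (0 < s1 - s2)%N by lia.
by apply/eqP; rewrite eqn_leq leq_divRL // -ltnS ltn_divLR //; lia.
Qed.

Lemma depth_bounds (s1 s2 r : nat) : (s2 < s1)%N -> (r < s1)%N ->
  (s1 <= r + (depth s1 s2 r).+1 * (s1 - s2))%N /\
  (r + depth s1 s2 r * (s1 - s2) < s1)%N.
Proof.
move=> s21 rs1; have a_gt0 : (0 < s1 - s2)%N by lia.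
have := divn_eq (s1 - 1 - r) (s1 - s2); have := ltn_pmod (s1 - 1 - r) a_gt0.
by rewrite /depth mulSn; lia.
Qed.

Lemma depth_shift (s1 s2 r : nat) : (s2 < s1)%N -> (r < s2)%N ->
  depth s1 s2 r = (depth s1 s2 (r + (s1 - s2))).+1.
Proof.
move=> s21 rs2; have [|lo hi] := @depth_bounds s1 s2 (r + (s1 - s2)) s21; first lia.
by apply: depth_eq; rewrite ?mulSn in lo hi *; lia.
Qed.

Lemma depth_top (s1 s2 r : nat) : (s2 <= r < s1)%N -> depth s1 s2 r = 0%N.
Proof. by move=> rP; apply: depth_eq; lia. Qed.

Lemma low_le_s2 (s1 s2 q r : nat) : (s2 < s1)%N -> (low s1 s2 q r <= s2)%N.
Proof. by move=> s21; rewrite /low mulSn; case: ifP; case: ifP; lia. Qed.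

(** Playing [s2] at residue [r] of lower half [q.+1] leads to residue [r + alpha] of upper half [q]
    and earns [s2 - (s1 - low) = low - alpha]. Truncation is harmless, as the other term is at least
    0. *)
Lemma low_shift (s1 s2 q r : nat) : (0 < s2 < s1)%N -> (r < s2)%N ->
  low s1 s2 q.+1 r =
    maxn (low s1 s2 q r) (low s1 s2 q (r + (s1 - s2)) - (s1 - s2)).
Proof.
move=> s2P rs2; rewrite {1 2}/low; case: ifP => s12.
  have := @low_le_s2 s1 s2 q (r + (s1 - s2)); rewrite divn_small //=; lia.
rewrite /low s12 depth_shift ?ltnS; try lia.
by set d := depth _ _ _; rewrite !mulSn; case: ifP; case: ifP; lia.
Qed.

Lemma low0_small (s1 s2 r : nat) : (0 < s2 < s1)%N -> (r < s2)%N ->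
  low s1 s2 0 r = 0%N.
Proof.
move=> s2P rs2; rewrite /low divn_small //= depth_shift ?if_same //; lia.
Qed.

Lemma low_le (s1 s2 q r : nat) : (0 < s2 < s1)%N -> (s1 < 2 * s2)%N ->
  (r < s1)%N -> (low s1 s2 q r <= r)%N.
Proof.
move=> s2P s12 rs1; have [||lo hi] := @depth_bounds s1 s2 r; try lia.
by rewrite /low; case: ifP; [lia | case: ifP; lia].
Qed.

Lemma low_top (s1 s2 q r : nat) : (0 < s2 < s1)%N -> (s1 < 2 * s2)%N ->
  (s2 <= r < s1)%N -> low s1 s2 q r = s2.
Proof. by move=> s2P s12 rP; rewrite /low depth_top //; case: ifP; lia. Qed.

(** A forced move flips the parity of [r %/ s2], so one of the two values is [s2] and the other
    0. *)
Lemma low_sub (s1 s2 q r : nat) : (0 < s2 < s1)%N -> (2 * s2 <= s1)%N ->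
  (s2 <= r)%N -> (low s1 s2 q r + low s1 s2 q (r - s2) = s2)%N.
Proof.
move=> s2P s12 rP; rewrite /low s12 -{1}(subnK rP) divnDr ?dvdnn // divnn.
by have -> : (0 < s2)%N by [lia]; rewrite addn1 /=; case: odd => /=; lia.
Qed.

(** At residue [r] of an upper half, this makes the move [s2], worth [s2 - low (r + alpha)], no
    better than the move [s1], worth [s1 - low r]. *)
Lemma low_shift_le (s1 s2 q r : nat) : (0 < s2 < s1)%N -> (r < s2)%N ->
  (low s1 s2 q r <= low s1 s2 q (r + (s1 - s2)) + (s1 - s2))%N.
Proof.
move=> s2P rs2; rewrite {1}/low; case: ifP => s12; first by rewrite divn_small.
rewrite /low s12 depth_shift; try lia.
by set d := depth _ _ _; rewrite !mulSn; case: ifP; case: ifP; lia.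
Qed.

Lemma outcome_lower0 (s1 s2 r : nat) : (0 < s2 < s1)%N -> (r < s1)%N ->
  outcome [:: s2; s1] r = (low s1 s2 0 r)%:Z.
Proof.
move=> s2P; elim/ltn_ind: r => r IHr rs1; case: (ltnP r s2) => [rs2 | s2r].
  by rewrite low0_small // outcome_small.
rewrite outcome_mid ?s2r // IHr; try lia.
case: (leqP (2 * s2) s1) => s12; first by have := low_sub 0 s2P s12 s2r; lia.
(* Here [r - s2 < s2], so a single move ends the game. *)
by rewrite (low_top _ _ _ (r := r)) ?(low0_small (r := r - s2)) ?s2r //; lia.
Qed.

Lemma outcome_upper (s1 s2 q r : nat) : (0 < s2 < s1)%N ->
  (forall t, (t < s1)%N ->
     outcome [:: s2; s1] (2 * s1 * q + t) = (low s1 s2 q t)%:Z) ->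
  (r < s1)%N ->
  outcome [:: s2; s1] (2 * s1 * q + s1 + r) = s1%:Z - (low s1 s2 q r)%:Z.
Proof.
move=> s2P lower; elim/ltn_ind: r => r IHr rs1.
have bd t : (low s1 s2 q t <= s2)%N by apply: low_le_s2; lia.
rewrite outcome_big //; last by lia.
have -> : (2 * s1 * q + s1 + r - s1 = 2 * s1 * q + r)%N by lia.
rewrite lower //; case: (ltnP r s2) => [rs2 | s2r].
  have -> : (2 * s1 * q + s1 + r - s2 = 2 * s1 * q + (r + (s1 - s2)))%N by lia.
  rewrite lower; last by lia.
  by have := low_shift_le q s2P rs2; lia.
have -> : (2 * s1 * q + s1 + r - s2 = 2 * s1 * q + s1 + (r - s2))%N by lia.
rewrite IHr; try lia.
(* The move [s1] wins if [low r + low (r - s2) + s2 <= 2 * s1]: by [bd] when [2 * s2 <= s1],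
   otherwise by [low (r - s2) <= r - s2]. *)
have := bd r; have := bd (r - s2)%N.
case: (leqP (2 * s2) s1) => s12; first by lia.
by have := @low_le s1 s2 q (r - s2) s2P s12; lia.
Qed.

Lemma outcome_lowerS (s1 s2 q r : nat) : (0 < s2 < s1)%N ->
  (forall t, (t < s1)%N -> outcome [:: s2; s1] (2 * s1 * q + s1 + t) =
     s1%:Z - (low s1 s2 q t)%:Z) ->
  (r < s1)%N ->
  outcome [:: s2; s1] (2 * s1 * q.+1 + r) = (low s1 s2 q.+1 r)%:Z.
Proof.
move=> s2P upper; elim/ltn_ind: r => r IHr rs1.
rewrite outcome_big //; last by rewrite mulnS; lia.
have -> : (2 * s1 * q.+1 + r - s1 = 2 * s1 * q + s1 + r)%N by rewrite mulnS; lia.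
rewrite upper //; case: (ltnP r s2) => [rs2 | s2r].
  have -> : (2 * s1 * q.+1 + r - s2 = 2 * s1 * q + s1 + (r + (s1 - s2)))%N.
    by rewrite mulnS; lia.
  by rewrite upper ?low_shift //; lia.
have -> : (2 * s1 * q.+1 + r - s2 = 2 * s1 * q.+1 + (r - s2))%N by lia.
rewrite IHr; try lia.
(* The move [s1] earns [low q r]. If [2 * s2 <= s1], then [low] is independent of [q] and the moves
   tie; otherwise [low q r] is already the maximal [s2]. *)
case: (leqP (2 * s2) s1) => s12.
  have := low_sub q s2P s12 s2r; have := low_sub q.+1 s2P s12 s2r.
  by rewrite /low s12; lia.
by rewrite !(low_top _ _ _ (r := r)) ?s2r //; lia.
Qed.

Lemma outcome_low (s1 s2 q r : nat) : (0 < s2 < s1)%N -> (r < s1)%N ->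
  outcome [:: s2; s1] (2 * s1 * q + r) = (low s1 s2 q r)%:Z.
Proof.
move=> s2P; elim: q r => [|q IHq] r rs1.
  by rewrite muln0 outcome_lower0.
by apply: outcome_lowerS => // t; apply: outcome_upper.
Qed.

(** As [i * s2 + (i - 1) * s1 = 2 * s1 * (i - 1) + (s1 - i * alpha)], X*(i) lies in the lower half
    of block [i - 1]; the condition on [i] says [s1 - i * alpha > 0]. *)
Lemma mem_Xstar (s1 s2 i y : nat) : (0 < s2 < s1)%N ->
  reflect (exists r, [/\ (0 < i)%N, ((i - 1) * s1 < i * s2)%N, (r < s1)%N,
                         depth s1 s2 r = (i - 1)%N & (y = 2 * s1 * (i - 1) + r)%N])
          (y \in Xstar s1 s2 i).
Proof.
move=> s2P; rewrite /Xstar; case: i => [|k]; first by constructor; case=> r [].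
rewrite subn1 /=; case: ifP => [kP | /negbT kP]; last first.
  by constructor; case=> r [_ kP' _ _ _]; case/negP: kP.
apply: (iffP mapP) => [[d] | [r [_ _ rs1 dr ->]]].
  rewrite mem_iota => dP ->.
  exists (k.+1 * s2 + d - k * s1)%N; split=> //.
  - by nia.
  - apply: depth_eq; nia.
  by nia.
have [||lo hi] := @depth_bounds s1 s2 r; try lia; rewrite dr in lo hi.
exists (2 * s1 * k + r - (k.+1 * s2 + k * s1))%N; last by nia.
by rewrite mem_iota; nia.
Qed.

Theorem corollary13 (s1 s2 : nat) (s2_gt0 : (0 < s2)%N) (s2_lt_s1 : (s2 < s1)%N) :
  let o := outcome [:: s2; s1] in
  let alpha := (s1 - s2)%N in
  [/\ (forall i x : nat, x \in Xstar s1 s2 i ->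
         (i = 1%N -> odd (x %/ s2)) ->
         o x = i%:Z * s2%:Z - (i%:Z - 1) * s1%:Z /\
         i%:Z * s2%:Z - (i%:Z - 1) * s1%:Z = s1%:Z - i%:Z * alpha%:Z),
      (forall i x y : nat, y \in Xstar s1 s2 i ->
         y%:Z - s1%:Z + i%:Z * alpha%:Z <= x%:Z -> (x < y)%N ->
         (forall j : nat, x \notin Xstar s1 s2 j) ->
         o x = 0),
      (forall i x y : nat, y \in Xstar s1 s2 i ->
         y = x %[mod 2 * s1] -> (y < x)%N ->
         o x = o y)
    & (forall x : nat, (s1 <= x %% (2 * s1) <= 2 * s1 - 1)%N ->
         o x = s1%:Z - o (x - s1)%N)].
Proof.
move=> o alpha; have s2P : (0 < s2 < s1)%N by rewrite s2_gt0.
split.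
- move=> i x /(mem_Xstar _ _ s2P)[r [i_gt0 iP rs1 dr ->]] odd_x.
  case: i i_gt0 iP dr odd_x => // k _; rewrite subn1 /= => kP dr odd_x.
  split; last by rewrite /alpha; nia.
  rewrite /o outcome_low // /low dr leqnn; case: ifP => s12; last by nia.
  (* [2 * s2 <= s1] and [k * s1 < k.+1 * s2] leave only X*(1). *)
  have k0 : k = 0%N by nia.
  by rewrite k0 muln0 add0n in odd_x *; rewrite odd_x //; lia.
- move=> i x y /(mem_Xstar _ _ s2P)[r [i_gt0 iP rs1 dr ->]] xlo xhi xnX.
  case: i i_gt0 iP dr xlo xhi => // k _; rewrite subn1 /= => kP dr xlo xhi.
  have [||lo hi] := @depth_bounds s1 s2 r; try lia; rewrite dr in lo hi.
  (* The lower bound on [x] keeps it in the block of [y], since [s1 <= r + k.+1 * alpha]. *)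
  have [t xE] : exists t, x = (2 * s1 * k + t)%N.
    by exists (x - 2 * s1 * k)%N; rewrite /alpha in xlo; nia.
  subst x; have ts1 : (t < s1)%N by lia.
  rewrite /o outcome_low //.
  have dt_ge : (k <= depth s1 s2 t)%N by rewrite -dr leq_div2r //; lia.
  (* Depth [k] would put [x] in X*(k+1) itself. *)
  have dt : (k < depth s1 s2 t)%N.
    rewrite ltn_neqAle dt_ge andbT; apply/eqP => kt.
    case/negP: (xnX k.+1); apply/(mem_Xstar _ _ s2P).
    by exists t; rewrite subn1 /=.
  rewrite /low (leqNgt (depth _ _ _)) dt /=; case: ifP => // s12.
  have k0 : k = 0%N by nia.
  rewrite divn_small // ltnNge; apply/negP => s2t.
  by move: dt; rewrite depth_top ?s2t.
- move=> i x y /(mem_Xstar _ _ s2P)[r [i_gt0 iP rs1 dr ->]] yx lt_yx.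
  have r_small : (r < 2 * s1)%N by lia.
  rewrite mulnC modnMDl (modn_small r_small) in yx.
  have xE : x = (2 * s1 * (x %/ (2 * s1)) + r)%N by rewrite yx mulnC -divn_eq.
  (* From block [i - 1] on, the value at a residue of depth [i - 1] no longer changes. *)
  have iq : (i - 1 <= x %/ (2 * s1))%N.
    by rewrite leq_divRL; lia.
  by rewrite {1}xE /o !outcome_low // /low dr leqnn iq.
- move=> x /andP[lo hi].
  have xE := divn_eq x (2 * s1); rewrite mulnC in xE.
  have xE' : x = (2 * s1 * (x %/ (2 * s1)) + s1 + (x %% (2 * s1) - s1))%N by lia.
  rewrite xE' /o outcome_upper //; try lia; last by move=> t; apply: outcome_low.
  by rewrite addnAC addnK outcome_low //; lia.
Qed.
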